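(* Let $k>1$ and $n\ge 1$ be integers and let $0\le m\le n$. If $\pi$ is chosen uniformly at random among the permutations of $S_{kn}$ having exactly $m$ cycles of length $k$, then \[ \mathbb{E}[\pi(1)\mid \pi\in S_{kn}\text{ has exactly } m\ k\text{-cycles}] = \frac{kn+1}{2}+\frac{(-1)^{n-m}}{2\,D(k,n-m)}, \] where $D(k,N)$ is the number of derangements of the generalized symmetric group $S(k,N)=(\mathbb{Z}/k\mathbb{Z})\wr S_N$.
   Context: A $k$-cycle of a permutation is a cycle of length exactly $k$ in its disjoint cycle decomposition (fixed points count as $1$-cycles). The generalized symmetric group $S(k,N)=(\mathbb{Z}/k\mathbb{Z})\wr S_N=(\mathbb{Z}/k\mathbb{Z})^N\rtimes S_N$ has elements $((x_1,\dots,x_N),\sigma)$ with $x_i\in\mathbb{Z}/k\mathbb{Z}$, $\sigma\in S_N$. Such an element is a derangement if for every $i\in\{1,\dots,N\}$, either $\sigma(i)\neq i$ or $x_i\neq 0$. $D(k,N)$ denotes the number of derangements of $S(k,N)$; in particular $D(k,0)=1$. *)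

(* Defs.v *)
From mathcomp Require Import all_boot all_order all_algebra all_fingroup.

Set Implicit Arguments.
Unset Strict Implicit.
Unset Printing Implicit Defensive.

Import GRing.Theory.
Local Open Scope ring_scope.

(** * The generalized symmetric group S(k, N) = (Z/k) wr S_N *)

(* (Z/k)^N is the additive group of row vectors over 'Z_k. Since 'Z_0 and 'Z_1
   both denote Z/2, everything below is meaningful for k > 1 only. *)

Section GenSym.

Variables k N : nat.

(* MathComp actions are right actions (and (s * t) i = t (s i)), hence the
   inverse: the i-th coordinate of x is moved to position s i. *)
Definition coord_perm (x : 'rV['Z_k]_N) (s : 'S_N) : 'rV['Z_k]_N :=
  col_perm s^-1%g x.

Lemma coord_perm1 : coord_perm^~ 1%g =1 id.
Proof. by move=> x; rewrite /coord_perm invg1 col_perm1. Qed.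

Lemma coord_permM (x : 'rV['Z_k]_N) : act_morph coord_perm x.
Proof. by move=> s t; rewrite /coord_perm invMg col_permM. Qed.

Definition coord_action : {action 'S_N &-> 'rV['Z_k]_N} :=
  TotalAction coord_perm1 coord_permM.

Lemma coord_is_groupAction : is_groupAction [set: 'rV['Z_k]_N] coord_action.
Proof.
move=> s _; rewrite /= inE; apply/andP; split.
  by apply/subsetP=> x _; rewrite inE.
by apply/morphicP=> x y _ _; rewrite !actpermE /= /coord_perm; apply: raddfD.
Qed.

Definition coord_groupAction := GroupAction coord_is_groupAction.

(* An element u of the external semidirect product is a pair whose components
   are a permutation u.1 : 'S_N and a vector u.2 : 'rV['Z_k]_N. It stands for
   the product u.1 * u.2; rewriting it as u.2' * u.1 permutes the coordinates
   of u.2 by u.1, which leaves those at fixed points of u.1 unchanged. The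
   notion of derangement is thus the same in both conventions. *)
Definition gensym : finGroupType := sdprod_by coord_groupAction.

Definition gensym_derangement (u : gensym) : bool :=
  [forall i : 'I_N, (u.1 i != i) || (u.2 0 i != 0)].

Definition num_derangements : nat :=
  #|[set u : gensym | gensym_derangement u]|.

End GenSym.

(** * Permutations with a given number of k-cycles *)

Section Cycles.

Variable T : finType.

Definition num_cycles (k : nat) (s : {perm T}) : nat :=
  #|[set C in porbits s | #|C| == k]|.

Definition perms_with_cycles (k m : nat) : {set {perm T}} :=
  [set s | num_cycles k s == m].

End Cycles.

Definition uniform_expectation (T : finType) (A : {set T}) (X : T -> rat) :
  rat := (\sum_(t in A) X t) / #|A|%:R.

(* 'I_(k * n) is {0, ..., kn - 1}: the point 1 of {1, ..., kn} is its element
   0, and the point represented by i is i.+1. *)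
Lemma muln_gt0_of (k n : nat) : (1 < k)%N -> (1 <= n)%N -> (0 < k * n)%N.
Proof. by move=> k_gt1 n_gt0; rewrite muln_gt0 (ltnW k_gt1). Qed.

Definition first_pt (k n : nat) (k_gt1 : (1 < k)%N) (n_ge1 : (1 <= n)%N) :
  'I_(k * n) := Ordinal (muln_gt0_of k_gt1 n_ge1).

(* Main.v *)
(** Only the fixed points of the random permutation matter: conjugating by the
    permutation that fixes the first point and reverses the order of the others
    pairs the values of pi(1), so the expectation is an affine function of the
    probability that pi(1) = 1.  Since k > 1, the permutations fixing 1 with m
    k-cycles are the permutations of the kn - 1 other points with m k-cycles.

    Write e_N for the sum of (-1/k)^i / i! over i <= N.  Double counting marked
    k-cycles shows that N! k^(-m) e_{N/k - m} / m! permutations of N points have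
    exactly m k-cycles, and sorting the elements of S(k, N) by the set of points
    that they move shows that D(k, N) = N! k^N e_N: both families satisfy
    recurrences that express exp(-X/k) exp(X/k) = 1.  The theorem follows from
    e_N - e_{N-1} = (-1/k)^N / N!. *)

Require Import Defs.
From mathcomp Require Import all_boot all_order all_algebra all_fingroup.
From mathcomp Require Import zify ring.

Set Implicit Arguments.
Unset Strict Implicit.
Unset Printing Implicit Defensive.

Import GRing.Theory Num.Theory.
Local Open Scope ring_scope.

(** * Truncated exponential series *)

(** The coefficient of [X^N] in exp(xX) / (1 - X). *)
Definition expsum (x : rat) (N : nat) : rat :=
  \sum_(i < N.+1) x ^+ i / i`!%:R.

Lemma factr_neq0 n : n`!%:R != 0 :> rat.
Proof. by rewrite pnatr_eq0 -lt0n fact_gt0. Qed.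

Lemma binr_fact n j : (j <= n)%N ->
  'C(n, j)%:R = n`!%:R / (j`!%:R * (n - j)`!%:R) :> rat.
Proof.
move=> le_jn; rewrite -(bin_fact le_jn) !natrM mulfK //.
by rewrite mulf_neq0 ?factr_neq0.
Qed.

(** Coefficients of degree [n] in exp(xX) exp(yX) = exp((x + y)X). *)
Lemma exp_convolution (x y : rat) n :
  \sum_(j < n.+1) x ^+ (n - j) / (n - j)`!%:R * (y ^+ j / j`!%:R)
  = (x + y) ^+ n / n`!%:R.
Proof.
rewrite exprDn mulr_suml; apply: eq_bigr => j _.
have le_jn : (j <= n)%N by rewrite -ltnS.
rewrite -[_ *+ 'C(_, _)]mulr_natr binr_fact //.
move: (x ^+ (n - j)) (y ^+ j) => a b.
have := factr_neq0 (n - j); have := factr_neq0 j; have := factr_neq0 n.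
move: n`!%:R j`!%:R (n - j)`!%:R => p q r p0 q0 r0.
by field; rewrite p0 q0 r0.
Qed.

Lemma expsumS x n : expsum x n.+1 = expsum x n + x ^+ n.+1 / n.+1`!%:R.
Proof. by rewrite /expsum big_ord_recr. Qed.

(* The product of exp(-yX) / (1 - X) and exp(yX) is 1 / (1 - X). *)
Lemma expsum_convolution (y : rat) n :
  \sum_(j < n.+1) expsum (- y) (n - j) * (y ^+ j / j`!%:R) = 1.
Proof.
elim: n => [|n IHn].
  by rewrite big_ord1 /expsum big_ord1 !expr0 fact0 divr1 mulr1.
(* The last terms of the partial sums add up to the coefficient of degree [n.+1] in exp(-yX)
   exp(yX), which is 0. *)
have conv0 := exp_convolution (- y) y n.+1.
rewrite addNr expr0n mul0r big_ord_recr /= subnn in conv0.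
rewrite big_ord_recr /= subnn [expsum _ 0]big_ord1.
under eq_bigr => j _ do rewrite subSn -1?ltnS // expsumS -subSn -1?ltnS // mulrDl.
by rewrite big_split /= -addrA conv0 addr0 IHn.
Qed.

Lemma sum_subsets (V : nmodType) (T : finType) (S : {set T}) (f : nat -> V) :
  \sum_(F : {set T} | F \subset S) f #|F|
  = \sum_(j < #|S|.+1) f j *+ 'C(#|S|, j).
Proof.
rewrite (partition_big (fun F : {set T} => inord #|F| : 'I_#|S|.+1) predT) //=.
apply: eq_bigr => j _; rewrite -cards_draws -sumr_const.
apply: eq_big => [F|F /andP[sFS /eqP <-]]; rewrite ?inE.
  by case sFS: (F \subset S) => //=; rewrite -val_eqE /= inordK // ltnS subset_leq_card.
by rewrite inordK // ltnS subset_leq_card.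
Qed.

(** * Splitting off a cycle, and conjugation *)

Section Orbits.

Variable T : finType.
Implicit Types (s t u w : {perm T}) (C S : {set T}) (x : T).

Lemma porbits_inP s C x : C \in porbits s -> x \in C -> porbit s x = C.
Proof. by case/imsetP=> y _ -> xy; apply/eqP; rewrite eq_porbit_mem. Qed.

Lemma porbits_closed s C x : C \in porbits s -> x \in C -> s x \in C.
Proof.
move=> Cs xC; rewrite -(porbits_inP Cs xC).
by have := mem_porbit s 1 x; rewrite expg1.
Qed.

Lemma porbit_eq_in s t C x : {in C, forall y, s y \in C} -> {in C, s =1 t} ->
  x \in C -> porbit s x = porbit t x.
Proof.
move=> Cs eq_st xC.
have expE i : (s ^+ i)%g x \in C /\ (s ^+ i)%g x = (t ^+ i)%g x.
  elim: i => [|i [Ci Ei]]; first by rewrite !expg0 perm1.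
  by rewrite !expgSr !permM -Ei -eq_st // Cs.
apply/setP=> y; apply/porbitP/porbitP=> [] [i ->]; exists i; by case: (expE i).
Qed.

Lemma porbit_fixed s x : s x = x -> porbit s x = [set x].
Proof.
move=> sx; rewrite (@porbit_eq_in s 1%g [set x]) ?set11 //.
- by apply/setP=> y; apply/porbitP/set1P=> [[i ->]|->];
    [rewrite expg1n perm1 | exists 0%N; rewrite expg0 perm1].
- by move=> y /set1P->; rewrite sx set11.
- by move=> y /set1P->; rewrite perm1.
Qed.

Lemma porbit_subset s S C : perm_on S s -> C \in porbits s -> (1 < #|C|)%N ->
  C \subset S.
Proof.
move=> Ss Cs C_gt1; apply/subsetP=> x xC; apply: contraLR C_gt1 => xS.
by rewrite -(porbits_inP Cs xC) porbit_fixed ?cards1 ?(out_perm Ss).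
Qed.

(** For fixed [C], these are the cyclic permutations of [C], extended by the identity. *)
Definition full_cycle C s := perm_on C s && (C \in porbits s).

(** A permutation with orbit [C] is uniquely [t * u], where [t] is its restriction to [C] and [u]
    fixes [C] pointwise. *)
Lemma sum_porbit_split (V : nmodType) S C (F : {perm T} -> V) : C \subset S ->
  \sum_(s | perm_on S s && (C \in porbits s)) F s
  = \sum_(t | full_cycle C t) \sum_(u | perm_on (S :\: C) u) F (t * u)%g.
Proof.
move=> sCS; rewrite pair_big /=.
pose r s : {perm T} := restr_perm C s.
rewrite (reindex_onto (fun p : {perm T} * {perm T} => (p.1 * p.2)%g)
  (fun s => (r s, ((r s)^-1 * s)%g))) /=; last by move=> s _; rewrite mulKVg.
have stabC s : {in C, forall x, s x \in C} -> s \in 'N(C | 'P)%g.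
  by move=> Cs; rewrite !inE /=; apply/subsetP=> x xC; rewrite inE /aperm Cs.
apply: eq_bigl => -[t u] /=; apply/idP/idP.
  case/andP=> /andP[onS orbC] /eqP[rt _].
  have Cs x : x \in C -> (t * u)%g x \in C by apply: porbits_closed.
  have onC : perm_on C t by rewrite -rt restr_perm_on.
  have tE : {in C, (t * u)%g =1 t}.
    by move=> x xC; rewrite -{2}rt restr_permE // stabC.
  apply/andP; split.
    rewrite /full_cycle onC; case/imsetP: orbC (orbC) => x _ Cx orbC /=.
    have xC : x \in C by rewrite Cx porbit_id.
    by apply/imsetP; exists x; rewrite // -(porbit_eq_in Cs tE).
  apply/subsetP=> x; rewrite inE in_setD; apply: contraR; rewrite negb_and negbK.
  have uE y : u y = (t * u)%g ((t^-1)%g y) by rewrite permM permKV.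
  case/orP=> [xC|xS]; rewrite uE.
    by rewrite tE ?permKV // perm_closed // perm_onV.
  have xC : x \notin C by apply: contra xS; apply: (subsetP sCS).
  by rewrite (out_perm (perm_onV onC)) // (out_perm onS).
case/andP=> /andP[onC orbC] onD.
have tE : {in C, t =1 (t * u)%g}.
  move=> x xC; rewrite permM (out_perm onD) //.
  by rewrite inE perm_closed // xC.
have Ct x : x \in C -> t x \in C by rewrite perm_closed.
have onS : perm_on S (t * u)%g.
  by apply: perm_onM; apply: subset_trans; [exact: onC| |exact: onD|exact: subsetDl].
rewrite onS /=; apply/andP; split.
  case/imsetP: orbC => x _ Cx.
  have xC : x \in C by rewrite Cx porbit_id.
  by apply/imsetP; exists x; rewrite // -(porbit_eq_in Ct tE).
suff -> : r (t * u)%g = t by rewrite mulKg.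
apply/permP=> x; have [xC|xC] := boolP (x \in C).
  by rewrite restr_permE // ?tE // stabC // => y yC; rewrite -tE ?Ct.
by rewrite !(@out_perm _ C) ?restr_perm_on.
Qed.

(** The orbits of [t * u] are [C] and those of [u] outside [C]. As [k != 1], the fixed points of [u]
    in [C] do not count. *)
Lemma num_cycles_split k C t u : k != 1%N -> full_cycle C t ->
  perm_on (~: C) u -> num_cycles k (t * u)%g = ((#|C| == k) + num_cycles k u)%N.
Proof.
move=> k_neq1 /andP[onC orbC] onD.
have tE : {in C, t =1 (t * u)%g}.
  by move=> x xC; rewrite permM (out_perm onD) // inE negbK perm_closed.
have uE : {in ~: C, u =1 (t * u)%g}.
  by move=> x; rewrite inE => xC; rewrite permM (out_perm onC).
have Ct : {in C, forall x, t x \in C} by move=> x; rewrite perm_closed.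
have Cu : {in ~: C, forall x, u x \in ~: C}.
  by move=> x; rewrite perm_closed.
have u1 x : x \in C -> porbit u x = [set x].
  by move=> xC; rewrite porbit_fixed // (out_perm onD) // inE negbK.
rewrite /num_cycles.
pose B := [set D in porbits u | #|D| == k].
pose A := [set D | (D == C) && (#|D| == k)].
have -> : [set D in porbits (t * u)%g | #|D| == k] = A :|: B.
  apply/setP=> D; rewrite !inE -andb_orl.
  case kD: (#|D| == k); rewrite ?andbF // !andbT; apply/imsetP/orP.
    case=> x _ Dx; have [xC|xC] := boolP (x \in C); [left|right].
      by rewrite Dx -(porbit_eq_in Ct tE xC) (porbits_inP orbC xC).
    by apply/imsetP; exists x; rewrite // Dx -(porbit_eq_in Cu uE) // inE.
  case=> [/eqP DC|/imsetP[x _ Dx]].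
    case/imsetP: orbC => x _ Cx; have xC : x \in C by rewrite Cx porbit_id.
    by exists x; rewrite // -(porbit_eq_in Ct tE xC) DC.
  exists x; rewrite // -(porbit_eq_in Cu uE) // inE.
  by apply: contra k_neq1 => xC; rewrite -(eqP kD) Dx u1 ?cards1.
(* [C] can be an orbit of [u] only as a singleton, whose size is not [k]. *)
rewrite cardsU [A :&: B](_ : _ = set0) ?cards0 ?subn0; last first.
  apply/setP=> D; rewrite !inE; apply/negP.
  case/and3P=> /andP[/eqP-> /eqP kC] /imsetP[x _ Cx] _.
  have xC : x \in C by rewrite Cx porbit_id.
  by move: k_neq1; rewrite -kC Cx u1 ?cards1.
congr (_ + _)%N; have [kC|kC] := boolP (#|C| == k).
  rewrite (_ : A = [set C]) ?cards1 //.
  by apply/setP=> D; rewrite !inE; have [->|] := eqVneq D C; rewrite ?kC.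
apply/eqP; rewrite cards_eq0; apply/eqP/setP=> D; rewrite !inE.
by have [->|] := eqVneq D C; rewrite ?(negbTE kC).
Qed.

Lemma porbitJ s w x : porbit (s ^ w)%g (w x) = w @: porbit s x.
Proof.
apply/setP=> y; apply/porbitP/imsetP.
  by case=> i ->; exists ((s ^+ i)%g x); rewrite ?mem_porbit // -conjXg permJ.
by case=> z /porbitP[i ->] ->; exists i; rewrite -conjXg permJ.
Qed.

(** The image under [w] is a bijection from the orbits of [s] to those of [s ^ w]. *)
Lemma num_cyclesJ k s w : num_cycles k (s ^ w)%g = num_cycles k s.
Proof.
rewrite /num_cycles -[RHS](card_imset _ (imset_inj (@perm_inj _ w))).
congr #|pred_of_set _|; apply/setP=> D; rewrite inE; apply/andP/imsetP.
  case=> /imsetP[x _ ->] /eqP kD; exists (porbit s (w^-1 x)%g).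
    rewrite inE imset_f //= -kD -{2}[x](permKV w) porbitJ.
    by rewrite card_imset //; apply: perm_inj.
  by rewrite -porbitJ permKV.
case=> D'; rewrite inE => /andP[/imsetP[x _ ->] /eqP kD ->].
split; first by rewrite -porbitJ imset_f.
by rewrite card_imset ?kD //; apply: perm_inj.
Qed.

End Orbits.

(** * Permutations with a given number of k-cycles *)

Section CycleCounts.

Variable T : finType.
Implicit Types (s t u : {perm T}) (C S : {set T}) (x : T).

Lemma card_perm_on S : (\sum_(s | perm_on S s) 1)%N = #|S|`!.
Proof. by rewrite sum1_card card_perm. Qed.

(** Sorts the permutations of [S] by the orbit [C] of [x]. *)
Lemma sum_full_cycles S x : x \in S ->
  (\sum_(C : {set T} | (x \in C) && (C \subset S)) #|full_cycle C| * #|S :\: C|`!)%N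
  = #|S|`!.
Proof.
move=> xS; rewrite -(card_perm_on S).
have onC s : perm_on S s -> porbit s x \subset S.
  move=> onS; apply/subsetP=> y /porbitP[i ->].
  by elim: i => [|i IHi]; rewrite ?expg0 ?perm1 // expgSr permM perm_closed.
rewrite (partition_big (fun s => porbit s x)
  (fun C => (x \in C) && (C \subset S))) /=; last first.
  by move=> s /onC ->; rewrite porbit_id.
apply: eq_bigr => C /andP[xC sCS].
rewrite (eq_bigl (fun s => perm_on S s && (C \in porbits s))); last first.
  move=> s; congr (_ && _); apply/eqP/idP=> [<-|Cs]; first exact: imset_f.
  exact: porbits_inP.
rewrite (sum_porbit_split _ sCS).
under eq_bigr do rewrite card_perm_on.
by rewrite sum_nat_const.
Qed.

(** Strong induction: [sum_full_cycles] determines the term of [C] from those of its proper subsets,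
    and the numbers (|D| - 1)! satisfy the same identity. *)
Lemma card_full_cycle C : (0 < #|C|)%N -> #|full_cycle C| = (#|C|.-1)`!.
Proof.
move: {2}#|C| (leqnn #|C|) => n; elim: n C => [|n IHn] C le_Cn.
  by rewrite lt0n -leqn0 le_Cn.
case/card_gt0P=> x xC; have := sum_full_cycles xC.
(* Removing [x] from [D] leaves a subset of [C :\ x]. With c the size of [C :\ x], each of the c + 1
   sizes of such subsets contributes c! in total. *)
have -> : #|C|`! = (\sum_(D : {set T} | (x \in D) && (D \subset C)) #|D|.-1`! * #|C :\: D|`!)%N.
  have C0 : #|C| = #|C :\ x|.+1 by rewrite (cardsD1 x) xC.
  rewrite (reindex_onto (fun D => x |: D) (fun D => D :\ x)) /=; last first.
    by move=> D /andP[xD _]; rewrite setD1K.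
  rewrite (eq_big (fun D : {set T} => D \subset C :\ x)
    (fun D : {set T} => #|D|`! * (#|C :\ x| - #|D|)`!)%N).
  - rewrite (sum_subsets (C :\ x) (fun i => i`! * (#|C :\ x| - i)`!)%N).
    rewrite (eq_bigr (fun=> #|C :\ x|`!)) => [|i _].
      by rewrite sum_nat_const card_ord C0 factS.
    have le_i : (i <= #|C :\ x|)%N by rewrite -ltnS.
    by rewrite -mulr_natr natn; apply: etrans (mulnC _ _) (bin_fact le_i).
  - move=> D; rewrite subsetD1 setU11 subUset sub1set xC /=.
    congr (_ && _); apply/eqP/idP=> [<-|xD]; first by rewrite !inE eqxx.
    by rewrite setU1K.
  move=> D /andP[/andP[_ sDC] /eqP DK].
  have xD : x \notin D by rewrite -DK !inE eqxx.
  by rewrite cardsU1 xD add1n /= cardsDS // cardsU1 xD C0.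
rewrite (bigD1 C) ?xC ?subxx //= [X in _ = X -> _](bigD1 C) ?xC ?subxx //=.
rewrite setDv cards0 !muln1.
rewrite [X in (_ + X)%N = _](eq_bigr (fun D : {set T} => #|D|.-1`! * #|C :\: D|`!)%N).
  by move/addIn.
move=> D /andP[/andP[xD sDC] neDC]; rewrite IHn //; last by apply/card_gt0P; exists x.
by rewrite -ltnS (leq_trans _ le_Cn) // proper_card // properEneq neDC.
Qed.

(** Permutations of [S] are encoded as permutations of [T] supported on [S], so that deleting a
    cycle does not change the type. For [k > 1] the fixed points outside [S] do not count. *)
Definition cycle_count k S m := #|[set s | perm_on S s & num_cycles k s == m]|.

Lemma cycle_countE k S m :
  cycle_count k S m = (\sum_(s | perm_on S s) (num_cycles k s == m))%N.
Proof.
by rewrite /cycle_count -sum1_card big_mkcond /= [RHS]big_mkcond; apply: eq_bigr => s _;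
  rewrite inE; case: (perm_on S s) => //=; case: eqP.
Qed.

(* Both sides count the pairs of a permutation and one of its k-cycles C. *)
Lemma cycle_count_rec k S m : (1 < k)%N ->
  (m.+1 * cycle_count k S m.+1 =
   \sum_(C : {set T} | (C \subset S) && (#|C| == k))
      k.-1`! * cycle_count k (S :\: C) m)%N.
Proof.
move=> k_gt1; rewrite cycle_countE big_distrr /=.
transitivity (\sum_(s | perm_on S s) \sum_(C : {set T} | (C \subset S) &&
    (#|C| == k)) (C \in porbits s) * (num_cycles k s == m.+1))%N.
  apply: eq_bigr => s onS; rewrite -big_distrl /=; case: eqP => [<-|]; last by rewrite !muln0.
  rewrite !muln1 /num_cycles -sum1_card big_mkcond [RHS]big_mkcond /=.
  apply: eq_bigr => C _; rewrite inE.
  case Cs: (C \in porbits s) => /=; last by case: ifP.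
  case: eqP => Ck; rewrite ?andbF ?andbT //.
  by rewrite (porbit_subset onS Cs) // Ck.
rewrite exchange_big /=; apply: eq_bigr => C /andP[sCS /eqP Ck].
transitivity (\sum_(s | perm_on S s && (C \in porbits s)) (num_cycles k s == m.+1))%N.
  by rewrite [RHS]big_mkcondr; apply: eq_bigr => s _; case: (C \in _); rewrite ?mul1n.
(* There are (k - 1)! choices of the cycle on [C]; the other factor must have [m] cycles of length
   [k]. *)
have <- : #|full_cycle C| = k.-1`! by rewrite card_full_cycle ?Ck ?(ltnW k_gt1).
rewrite (sum_porbit_split _ sCS) -sum_nat_const; apply: eq_bigr => t fc; rewrite cycle_countE.
apply: eq_bigr => u onD; rewrite (@num_cycles_split _ k C) ?Ck ?eqxx //.
  by case: (k) k_gt1 => [|[]].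
by apply: subset_trans onD _; rewrite setDE subsetIr.
Qed.

(** The [k]-cycles are disjoint and, since [k > 1], contained in [S]. *)
Lemma leq_num_cycles k S s : (1 < k)%N -> perm_on S s ->
  (k * num_cycles k s <= #|S|)%N.
Proof.
move=> k_gt1 onS; pose P := [set C in porbits s | #|C| == k].
have tP : trivIset P.
  apply/trivIsetP=> A B; rewrite !inE => /andP[As _] /andP[Bs _] neAB.
  apply/pred0P=> x /=; apply: contraNF neAB => /andP[xA xB].
  by rewrite -(porbits_inP As xA) -(porbits_inP Bs xB).
have -> : (k * num_cycles k s)%N = #|cover P|.
  rewrite -(eqP tP) (eq_bigr (fun=> k)) ?sum_nat_const 1?mulnC // => C.
  by rewrite inE => /andP[_ /eqP].
apply: subset_leq_card; apply/bigcupsP=> C; rewrite inE => /andP[Cs /eqP Ck].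
by rewrite (porbit_subset onS Cs) // Ck.
Qed.

Lemma cycle_count_small k S m : (1 < k)%N -> (#|S| < k * m)%N ->
  cycle_count k S m = 0%N.
Proof.
move=> k_gt1 ltSm; rewrite cycle_countE big1 // => s onS.
by case: eqP ltSm => // <-; rewrite ltnNge leq_num_cycles.
Qed.

Lemma sum_cycle_count k S : (1 < k)%N ->
  (\sum_(m < (#|S| %/ k).+1) cycle_count k S m)%N = #|S|`!.
Proof.
move=> k_gt1; rewrite -card_perm_on.
rewrite (eq_bigr _ (fun (i : 'I_(#|S| %/ k).+1) _ => cycle_countE k S i)).
rewrite exchange_big /=; apply: eq_bigr => s onS.
have lt_s : (num_cycles k s < (#|S| %/ k).+1)%N.
  by rewrite ltnS leq_divRL ?(ltnW k_gt1) // mulnC leq_num_cycles.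
rewrite (bigD1 (Ordinal lt_s)) //= eqxx big1 // => i.
by rewrite -val_eqE /= eq_sym => /negbTE->.
Qed.

(** The guard matters: for larger [m], truncated subtraction would make the last factor 1, while the
    count is 0. *)
Definition cycle_count_formula k S m := (k * m <= #|S|)%N ->
  (cycle_count k S m)%:R =
  #|S|`!%:R * (k%:R^-1 ^+ m / m`!%:R) * expsum (- k%:R^-1) (#|S| %/ k - m).

(** Inserts the formula into [cycle_count_rec]; choosing [C], a cycle on it and a permutation of the
    rest gives binomial(|S|, k) (k - 1)! (|S| - k)! = |S|! / k. *)
Lemma cycle_count_formulaS k S m : (1 < k)%N ->
  (forall C, C \subset S -> #|C| = k -> cycle_count_formula k (S :\: C) m) ->
  cycle_count_formula k S m.+1.
Proof.
move=> k_gt1 IH le_mS; have k_gt0 := ltnW k_gt1.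
have k0 : k%:R != 0 :> rat by rewrite pnatr_eq0 -lt0n.
have le_kS : (k <= #|S|)%N by apply: leq_trans le_mS; rewrite leq_pmulr.
have m0 : m.+1%:R != 0 :> rat by rewrite pnatr_eq0.
apply: (mulfI m0); rewrite -natrM cycle_count_rec //.
rewrite natr_sum (eq_bigr (fun=> k.-1`!%:R * ((#|S| - k)`!%:R *
   (k%:R^-1 ^+ m / m`!%:R) * expsum (- k%:R^-1) (#|S| %/ k - m.+1)))); last first.
  move=> C /andP[sCS /eqP Ck]; rewrite natrM IH ?cardsDS ?Ck //; last first.
    by rewrite leq_subRL // -mulnS.
  (* Removing [k] points lowers the quotient by [k] by one, so the index of [expsum] does not
     change. *)
  by rewrite -{4}(subnKC le_kS) divnDl // divnn k_gt0 add1n subSS.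
rewrite sumr_const -[X in _ *+ X]cardsE cards_draws.
rewrite -[_ *+ 'C(_, _)]mulr_natl binr_fact // factS natrM exprS.
have -> : k`! = (k * k.-1`!)%N by rewrite -{1 2}(prednK k_gt0) factS.
have := factr_neq0 k.-1; have := factr_neq0 m; have := factr_neq0 (#|S| - k).
rewrite natrM; move: (expsum _ _) (_ ^+ m) => e p.
move: (k.-1)`!%:R m`!%:R (#|S| - k)`!%:R #|S|`!%:R => a b c d c0 b0 a0.
by field; rewrite nat1r ?a0 ?b0 ?c0 ?k0 ?m0.
Qed.

(** Strong induction on [#|S|]: positive [m] follows by removing a cycle, then [m = 0] by
    subtracting the other counts from |S|!. *)
Lemma cycle_countP k S m : (1 < k)%N -> cycle_count_formula k S m.
Proof.
move=> k_gt1; have k_gt0 := ltnW k_gt1.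
have [n ltSn] := ubnP #|S|; elim: n S m ltSn => // n IHn S m ltSn.
have posm i : cycle_count_formula k S i.+1.
  apply: cycle_count_formulaS => // C sCS Ck; apply: IHn.
  rewrite cardsDS // Ck -ltnS (leq_trans _ ltSn) // ltnS ltn_subrL k_gt0 /=.
  by rewrite (leq_trans k_gt0) // -Ck subset_leq_card.
case: m => // _; set M := (#|S| %/ k)%N; rewrite subn0 expr0 fact0 divr1.
have := congr1 (fun i => i%:R : rat) (sum_cycle_count S k_gt1).
have := expsum_convolution k%:R^-1 M.
(* Up to the factor |S|!, the term of index 0 in [e1] is the value sought and the others are the
   counts for [m > 0]. *)
rewrite natr_sum !big_ord_recl /= subn0 expr0 fact0 divr1 -/M => e1.
rewrite (eq_bigr (fun i : 'I_M => #|S|`!%:R * (expsum (- k%:R^-1) (M - lift ord0 i) *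
   (k%:R^-1 ^+ lift ord0 i / (lift ord0 i)`!%:R)))) => [|i _].
  rewrite -mulr_sumr => /(canRL (addrK _)) ->.
  by have /(canRL (addrK _)) -> := e1; rewrite mulrBr mulr1.
rewrite posm; last by rewrite mulnC -leq_divRL.
by rewrite -mulrA [_ / _ * _]mulrC.
Qed.

End CycleCounts.

(** * Derangements of the generalized symmetric group *)

Section Derangements.

Variables (T Y : finType) (y0 : Y).
Implicit Types (S : {set T}) (p : {perm T} * {ffun T -> Y}).

(** Plain pairs stand for the elements of S(k, N), with [Y] for Z/k and [y0] for 0. Derangements are
    the pairs with [moved p = setT]. *)
Definition moved p := [set i | (p.1 i != i) || (p.2 i != y0)].

(** Both sides count the pairs of a permutation supported on [S] and a function equal to [y0] off
    [S]. *)
Lemma sum_card_moved S :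
  (\sum_(F : {set T} | F \subset S) #|[set p | moved p == F]|)%N
  = (#|S|`! * #|Y| ^ #|S|)%N.
Proof.
transitivity #|[set p | moved p \subset S]|.
  rewrite -sum1_card (partition_big moved (fun F => F \subset S)) /=; last first.
    by move=> p; rewrite inE.
  apply: eq_bigr => F sFS; rewrite -sum1_card; apply: eq_bigl => p.
  by rewrite !inE; case: eqP => [->|]; rewrite ?andbF ?sFS.
rewrite -card_perm -(card_pffun_on y0 (mem S) (mem Y)) -cardX.
apply: eq_card => -[s f]; rewrite !inE /=; apply/subsetP/andP.
  move=> sub; split.
    by apply/subsetP=> i si; apply: sub; rewrite inE /=; move: si; rewrite inE /= => ->.
  apply/pffun_onP; split=> //; apply/subsetP=> i fi; apply: sub.
  by rewrite inE /= orbC; move: fi; rewrite inE => ->.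
case=> onS /pffun_onP[fS _] i; rewrite inE /= => /orP[si|fi]; first by apply: (subsetP onS).
by apply: (subsetP fS).
Qed.

(** Strong induction: [sum_card_moved] determines the term of [S] from those of its proper subsets,
    and [d] satisfies the same identity. *)
Lemma card_moved S : (0 < #|Y|)%N ->
  #|[set p | moved p == S]|%:R
  = #|S|`!%:R * #|Y|%:R ^+ #|S| * expsum (- #|Y|%:R^-1) #|S|.
Proof.
move=> Y_gt0; have Y0 : #|Y|%:R != 0 :> rat by rewrite pnatr_eq0 -lt0n.
pose d n : rat := n`!%:R * #|Y|%:R ^+ n * expsum (- #|Y|%:R^-1) n.
rewrite -[RHS]/(d _); have [n ltSn] := ubnP #|S|; elim: n S ltSn => // n IHn S ltSn.
have : \sum_(F : {set T} | F \subset S) d #|F| = (#|S|`! * #|Y| ^ #|S|)%:R.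
  (* After replacing j by |S| - j and dividing by |S|! |Y|^|S|, this is [expsum_convolution] at
     1/|Y|. *)
  rewrite sum_subsets (reindex_inj rev_ord_inj) natrM natrX.
  rewrite -[RHS]mulr1 -[X in _ = _ * X](expsum_convolution #|Y|%:R^-1 #|S|) mulr_sumr;
  apply: eq_bigr => j _ /=.
  have le_jS : (j <= #|S|)%N by rewrite -ltnS.
  rewrite subSS bin_sub // /d -[_ *+ 'C(_, _)]mulr_natr binr_fact //.
  have -> : #|Y|%:R ^+ #|S| = #|Y|%:R ^+ (#|S| - j) * #|Y|%:R ^+ j :> rat.
    by rewrite -exprD subnK.
  rewrite exprVn.
  have := factr_neq0 j; have := factr_neq0 (#|S| - j).
  have: #|Y|%:R ^+ j != 0 :> rat by rewrite expf_neq0.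
  move: (expsum _ _) (_ ^+ j) (_ ^+ (_ - j)) => e a b.
  by move: j`!%:R (_ - j)`!%:R #|S|`!%:R => p q r a0 q0 p0; field; rewrite ?a0 ?p0 ?q0.
rewrite -sum_card_moved natr_sum (bigD1 S) //= [RHS](bigD1 S) //=.
rewrite [X in _ = _ + X](eq_bigr (fun F : {set T} => d #|F|)); first by move/addIr.
move=> F /andP[sFS neFS]; apply: IHn.
by rewrite -ltnS (leq_trans _ ltSn) // ltnS proper_card // properEneq neFS.
Qed.

End Derangements.

Definition gensym_pair k N (s : 'S_N) (x : 'rV['Z_k]_N) : gensym k N :=
  SdPair (coord_groupAction k N) (introT setXP (conj (in_setT s) (in_setT x))).

(** The bijection [h] from pairs to [gensym] matches the derangements with the pairs that move every
    point. *)
Lemma num_derangementsE k N : (1 < k)%N ->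
  (num_derangements k N)%:R = N`!%:R * k%:R ^+ N * expsum (- k%:R^-1) N.
Proof.
move=> k_gt1; have cardZ : #|'Z_k| = k by rewrite card_ord Zp_cast.
have := @card_moved 'I_N 'Z_k 0 setT; rewrite cardZ cardsT card_ord.
move=> <-; last exact: ltnW.
congr _%:R; rewrite /num_derangements.
pose h (p : {perm 'I_N} * {ffun 'I_N -> 'Z_k}) : gensym k N :=
  gensym_pair p.1 (\row_i p.2 i).
have hE p : val (h p) = (p.1, \row_i p.2 i) by [].
have h_inj : injective h.
  move=> p q /(congr1 val); rewrite !hE => -[eq1 /rowP eq2].
  case: p q eq1 eq2 => [s f] [t g] /= -> eq2; congr (_, _).
  by apply/ffunP=> i; have := eq2 i; rewrite !mxE.
rewrite -(card_imset _ h_inj); congr #|pred_of_set _|; apply/setP=> u.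
have uE : u = h (u.1, [ffun i => u.2 0 i]).
  apply: val_inj; rewrite hE /=; case: (u) => [[s x] /= _]; congr (_, _).
  by apply/rowP=> i; rewrite mxE ffunE.
have dE p : gensym_derangement (h p) = (moved 0 p == setT).
  rewrite /gensym_derangement.
  have -> : (h p).1 = p.1 by rewrite [pair_of_sd _]hE.
  have -> : (h p).2 = \row_i p.2 i by rewrite [pair_of_sd _]hE.
  apply/forallP/eqP=> [dp|/setP dp i].
    by apply/setP=> i; have := dp i; rewrite !inE mxE.
  by have := dp i; rewrite !inE mxE.
rewrite inE; apply/idP/imsetP=> [|[p]].
  by rewrite {1}uE dE => dp; exists (u.1, [ffun i => u.2 0 i]); rewrite // inE.
by rewrite inE -dE => dp ->.
Qed.

(** The identity permutation with all coordinates 1 is a derangement. *)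
Lemma num_derangements_neq0 k N : (1 < k)%N -> num_derangements k N != 0%N.
Proof.
move=> k_gt1; rewrite -lt0n; apply/card_gt0P.
exists (gensym_pair 1%g (const_mx 1)).
rewrite inE; apply/forallP=> i.
by rewrite /= mxE oner_neq0 orbT.
Qed.

(** * Conjugation symmetry and the expectation *)

(* Conjugation by the permutation that fixes p and reverses the order of the
   other points sends s p to N - s p, unless s fixes p. *)
Lemma sum_image_conj_closed N (p : 'I_N) (A : {set 'S_N}) : val p = 0%N ->
  (forall s w, s \in A -> (s ^ w)%g \in A) ->
  (\sum_(s in A) (s p).+1 * 2 + N * #|[set s in A | s p == p]|
   = (N + 2) * #|A|)%N.
Proof.
case: N p A => [[]//|N] p A p0 AJ; have {p0}-> : p = ord0 by apply: val_inj.
(* Negation modulo [N.+1] fixes 0 and sends [j > 0] to [N.+1 - j]. *)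
have w_inj : injective (fun i : 'I_N.+1 => - i) by apply: oppr_inj.
pose w := perm w_inj; have w0 : w ord0 = ord0 by rewrite permE; apply: oppr0.
have AJE s : ((s ^ w)%g \in A) = (s \in A).
  by apply/idP/idP=> /AJ; [move/(_ w^-1%g); rewrite conjgK | apply].
have wE s : (s ^ w)%g ord0 = w (s ord0) by rewrite -{1}w0 permJ.
have wK i : w (w i) = i by rewrite !permE opprK.
rewrite -sum1_card big_distrr /= -[#|A|]sum1_card big_distrr /=.
have -> : (\sum_(s in A) (s ord0).+1 * 2)%N
    = (\sum_(s in A) ((s ord0).+1 + (w (s ord0)).+1))%N.
  rewrite big_split /= [X in _ = (_ + X)%N](_ : _ = \sum_(s in A) (s ord0).+1)%N.
    by rewrite -big_split; apply: eq_bigr => s _; rewrite muln2 -addnn.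
  rewrite (reindex_inj (conjg_inj w)) /=.
  by apply: eq_big => [s|s _]; rewrite ?AJE // wE wK.
rewrite [X in (_ + X)%N = _](_ : _ = \sum_(s in A) (s ord0 == ord0) * N.+1)%N; last first.
  rewrite big_mkcond [RHS]big_mkcond; apply: eq_bigr => s _; rewrite inE.
  by case: (s \in A) => //=; case: eqP; rewrite ?muln1 ?mul1n.
(* Each [s] contributes [N.+1 + 2]: as 1 + 1 + [N.+1] if it fixes 0, and as (j + 1) + ([N.+1] - j +
   1) if it sends 0 to [j > 0]. *)
rewrite -big_split /=; apply: eq_bigr => s _; rewrite muln1 permE.
rewrite -val_eqE /=; case: (s ord0) => /= -[|j] lt_j /=.
  by rewrite subn0 modnn; lia.
by rewrite modn_small; lia.
Qed.

Theorem theorem3p8 (k n m : nat) (k_gt1 : (1 < k)%N) (n_ge1 : (1 <= n)%N)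
    (m_le_n : (m <= n)%N) :
  uniform_expectation (perms_with_cycles 'I_(k * n) k m)
      (fun s : 'S_(k * n) => (s (first_pt k_gt1 n_ge1)).+1%:R)
  = (k * n + 1)%:R / 2%:R
    + (-1) ^+ (n - m) / (2%:R * (num_derangements k (n - m))%:R).
Proof.
rewrite /uniform_expectation; set A := perms_with_cycles _ _ _.
set p := first_pt _ _; have k_gt0 := ltnW k_gt1.
have k0 : k%:R != 0 :> rat by rewrite pnatr_eq0 -lt0n.
have kn_gt0 := muln_gt0_of k_gt1 n_ge1.
have AJ s w : s \in A -> (s ^ w)%g \in A by rewrite !inE num_cyclesJ.
have AE : #|A| = cycle_count k [set: 'I_(k * n)] m.
  apply: eq_card => s; rewrite !inE.
  by rewrite [perm_on _ _](_ : _ = true) //; apply/subsetP=> i; rewrite inE.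
have BE : #|[set s in A | s p == p]| = cycle_count k (~: [set p]) m.
  apply: eq_card => s; rewrite !inE andbC; congr (_ && _).
  apply/eqP/subsetP=> [sp i|sp]; first by rewrite !inE; apply: contraNneq => ->; rewrite sp.
  by apply/eqP; apply: contraT => /sp; rewrite !inE eqxx.
have cardC : #|~: [set p]| = (k * n).-1 by rewrite cardsC1 card_ord.
pose c : rat := k%:R^-1 ^+ m / m`!%:R.
have c0 : c != 0 by rewrite mulf_neq0 ?invr_eq0 ?factr_neq0 // expf_neq0 // invr_eq0.
have D0 := num_derangements_neq0 (n - m) k_gt1.
rewrite -(pnatr_eq0 rat) in D0.
have DE := num_derangementsE (n - m) k_gt1.
have {}AE : #|A|%:R = (k * n)`!%:R * c * expsum (- k%:R^-1) (n - m).
  by rewrite AE cycle_countP // cardsT card_ord ?leq_mul2l ?m_le_n ?orbT // mulKn.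
(* Since (kn - 1) %/ k = n - 1, fixing [p] drops the last term of [expsum]. *)
have {}BE : (k * n)%:R * #|[set s in A | s p == p]|%:R = (k * n)`!%:R * c *
    (expsum (- k%:R^-1) (n - m) - (- k%:R^-1) ^+ (n - m) / (n - m)`!%:R).
  have lt_kn : ((k * n).-1 < k * n)%N by rewrite prednK.
  have -> : (k * n)`! = (k * n * (k * n).-1`!)%N by rewrite -{1 2}(prednK kn_gt0) factS.
  rewrite [(_ * _.-1`!)%:R]natrM -!mulrA; congr (_ * _); rewrite BE.
  (* If [m = n], too few points remain for [m] cycles, and the difference of sums is 1 - 1. *)
  have [lt_mn|] := ltnP m n; last first.
    move=> le_nm; have <- : n = m by apply/eqP; rewrite eqn_leq le_nm.
    rewrite cycle_count_small ?cardC //.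
    by rewrite subnn /expsum big_ord1 subrr !mulr0.
  have le_km : (k * m <= (k * n).-1)%N by rewrite -ltnS prednK // ltn_pmul2l.
  rewrite cycle_countP ?cardC // -!mulrA.
  congr (_ * (_ * _)); have -> : ((k * n).-1 %/ k = n.-1)%N.
    by rewrite divn_pred mulKn // dvdn_mulr // subn1.
  have -> : (n - m = (n.-1 - m).+1)%N by lia.
  by rewrite expsumS addrK.
have := sum_image_conj_closed (erefl : val p = 0%N) AJ.
move/(congr1 (fun i => i%:R : rat)); rewrite natrD [(_ * #|A|)%:R]natrM.
rewrite natrM BE AE natr_sum => sumE.
have {}sumE : 2%:R * \sum_(s in A) (s p).+1%:R = (k * n)`!%:R * c *
    ((k * n + 1)%:R * expsum (- k%:R^-1) (n - m)
     + (- k%:R^-1) ^+ (n - m) / (n - m)`!%:R).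
  rewrite mulr_sumr -[LHS](addrK ((k * n)`!%:R * c *
    (expsum (- k%:R^-1) (n - m) - (- k%:R^-1) ^+ (n - m) / (n - m)`!%:R))).
  rewrite (eq_bigr (fun s : 'S_(k * n) => ((s p).+1 * 2)%:R)) ?sumE; last first.
    by move=> s _; rewrite natrM mulrC.
  by rewrite !natrD; ring.
have E0 : expsum (- k%:R^-1) (n - m) != 0.
  by apply: contraNneq D0 => E0; rewrite DE E0 mulr0.
have /(canRL (mulKf (_ : 2%:R != 0 :> rat))) -> // := sumE.
(* With N = n - m and e the value of [expsum], dividing by [#|A|] cancels (kn)! [c], and (-1/k)^N /
   (N! e) = (-1)^N / D(k, N). *)
rewrite DE.
rewrite -[- k%:R^-1]mulN1r exprMn exprVn.
have := factr_neq0 (n - m); have := factr_neq0 (k * n).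
have : k%:R ^+ (n - m) != 0 :> rat by rewrite expf_neq0.
clear AE BE sumE DE D0; clearbody c.
move: E0 c0; rewrite -[- k%:R^-1]mulN1r.
move: (expsum _ _) c (k%:R ^+ (n - m)) ((-1) ^+ (n - m)) (k * n + 1)%:R.
move: (k * n)`!%:R (n - m)`!%:R => a b E d e f g E0 d0 e0 a0 b0.
by field; rewrite E0 d0 e0 a0 b0.
Qed.
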